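(* Let $\{a_n\}_{n\in\mathbb{N}}$ and $\{b_n\}_{n\in\mathbb{N}}$ be sequences of positive integers with $a_n\le b_n$ for all $n$, let $\{c_n\}_{n\in\mathbb{N}},\{d_n\}_{n\in\mathbb{N}}$ be sequences of real numbers, and let $\psi:\mathbb{N}\to[0,\infty)$. Let $$M(\psi)=\{x\in[0,1]:\ \|a_nx+c_n\|\cdot\|b_nx+d_n\|<\psi(n)\text{ for infinitely many }n\in\mathbb{N}\}.$$ (a) For $s\in(0,1)$, if $$\sum_{n\in\mathbb{N}}b_n\left(\frac{\psi(n)}{b_n}\right)^s+\sum_{n\in\mathbb{N}}\gcd(a_n,b_n)\left(\frac{\psi(n)}{a_nb_n}\right)^{s/2}<\infty,\qquad(\ast)$$ then $\mathcal{H}^s(M(\psi))=0$. (b) If $$\sum_{n\in\mathbb{N}}\psi(n)\log\frac{1}{\psi(n)}+\sum_{n\in\mathbb{N}}\gcd(a_n,b_n)\left(\frac{\psi(n)}{a_nb_n}\right)^{1/2}<\infty,$$ then $\lambda(M(\psi))=0$. In particular, $\dim_{\mathrm H}M(\psi)\le\min\{1,\tau\}$, where $\tau$ is the infimum of those $s>0$ for which $(\ast)$ holds.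
   Context: $\mathbb{N}$ is the set of positive integers. $\|x\|$ denotes the distance from $x\in\mathbb{R}$ to the nearest integer. $\mathcal{H}^s$ is the $s$-dimensional Hausdorff measure, $\lambda$ is Lebesgue measure, $\dim_{\mathrm H}$ is Hausdorff dimension. The logarithm $\log x$ is the natural logarithm, with the convention that $\log x$ is defined to be $1$ for $x\le e$ (terms with $\psi(n)=0$ contribute $0$). *)

(* Defs.v *)
From HB Require Import structures.
From mathcomp Require Import all_boot all_order all_algebra.
From mathcomp Require Import all_classical all_reals all_analysis.

Set Implicit Arguments.
Unset Strict Implicit.
Unset Printing Implicit Defensive.

Import Order.TTheory GRing.Theory Num.Theory.
Import numFieldNormedType.Exports.

Local Open Scope classical_set_scope.
Local Open Scope ring_scope.

Section Hausdorff.
Context {R : realType}.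
Implicit Types (A : set R) (s delta : R).

(* The maximum with 0 only matters for the empty set, whose supremum is -oo. *)
Definition diam A : \bar R :=
  maxe 0%E (ereal_sup [set (`|x - y|)%:E | x in A & y in A]).

(* The empty set weighs 0 for every s, also for s = 0 where 0 `^ 0 = 1: finite
   covers are thus sequences that are eventually empty, and the
   0-dimensional measure is the counting measure. *)
Definition diam_pow s A : \bar R :=
  if A == set0 then 0%E else (diam A `^ s)%E.

Definition delta_cover delta A (U : (set R)^nat) : Prop :=
  A `<=` \bigcup_k U k /\ forall k, (diam (U k) <= delta%:E)%E.

Definition hausdorff_content s delta A : \bar R :=
  ereal_inf [set (\sum_(0 <= k <oo) diam_pow s (U k))%E
            | U in delta_cover delta A].

Definition hausdorff_measure s A : \bar R :=
  ereal_sup [set hausdorff_content s delta A | delta in [set e : R | 0 < e]].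

Definition hausdorff_dim A : \bar R :=
  ereal_inf [set s%:E | s in [set t : R | 0 <= t /\ hausdorff_measure t A = 0%E]].

End Hausdorff.

Section Approximation.
Context {R : realType}.

Definition dist_int (x : R) : R := inf [set `|x - z%:~R| | z in [set: int]].

Definition tlog (x : R) : R := if x <= expR 1 then 1 else ln x.

(* Sequences indexed by the positive integers are functions on nat whose value
   at 0 is never used. *)

Definition approx_set (a b : nat -> nat) (c d psi : nat -> R) : set R :=
  [set x : R | 0 <= x <= 1 /\
    infinite_set [set n | (0 < n)%N /\
      dist_int ((a n)%:R * x + c n) * dist_int ((b n)%:R * x + d n) < psi n]].

Definition gcd_series (a b : nat -> nat) (psi : nat -> R) (s : R) : \bar R :=
  (\sum_(1 <= n <oo)
     ((gcdn (a n) (b n))%:R *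
      (psi n / ((a n)%:R * (b n)%:R)) `^ (s / 2))%:E)%E.

Definition hausdorff_cond (a b : nat -> nat) (psi : nat -> R) (s : R) : Prop :=
  (\sum_(1 <= n <oo) ((b n)%:R * (psi n / (b n)%:R) `^ s)%:E
   + gcd_series a b psi s < +oo)%E.

(* A term with psi n = 0 is 0, as it should be, because of the factor psi n.
   In gcd_series the exponent 1 / 2 is the case s = 1. *)
Definition lebesgue_cond (a b : nat -> nat) (psi : nat -> R) : Prop :=
  (\sum_(1 <= n <oo) (psi n * tlog (1 / psi n))%:E
   + gcd_series a b psi 1 < +oo)%E.

Definition tau (a b : nat -> nat) (psi : nat -> R) : \bar R :=
  ereal_inf [set s%:E | s in [set t : R | 0 < t /\ hausdorff_cond a b psi t]].

End Approximation.

(* Main.v *)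
(* Fix n and write g = gcd(a, b). If ||ax+c|| <= u and ||bx+d|| <= v, then x is
   within u/a of (p-c)/a and within v/b of (q-d)/b for some integers p, q, so
   bp - aq lies in an interval of length 2(ub + va). As bp - aq is a multiple of
   g, and each value is taken by O(g) of the relevant pairs (p, q), such x are
   covered by O(g + ub + va) sets of diameter at most 2 min(u/a, v/b). The set
   ||ax+c|| ||bx+d|| < psi is the union of such sets with u = 2^-i and
   v = 2 psi 2^i, where 0 <= i <= I and 2^I is about 1/psi. Over i, the terms
   with g sum to O(g (psi/(ab))^(s/2)) as min(u/a, v/b) decays geometrically on
   both sides of its maximum, and the terms with ub and va sum to
   O(b (psi/b)^s) times the sum of the 2^((s-1)i), which is bounded for s < 1
   and I + 1 = O(log(1/psi)) for s = 1. Both parts then follow from the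
   Borel-Cantelli lemma for the s-dimensional Hausdorff content, which vanishes
   exactly on H^s-null sets and, for s = 1, dominates half the Lebesgue outer
   measure. *)
Require Import Defs.
From HB Require Import structures.
From mathcomp Require Import all_boot all_order all_algebra.
From mathcomp Require Import all_classical all_reals all_analysis.
From mathcomp Require Import ring lra zify.

Set Implicit Arguments.
Unset Strict Implicit.
Unset Printing Implicit Defensive.

Import Order.TTheory GRing.Theory Num.Theory.
Import numFieldNormedType.Exports.

Local Open Scope classical_set_scope.
Local Open Scope ring_scope.

(** * Hausdorff content as an outer measure, and its null sets *)

Section HausdorffContent.
Context {R : realType}.
Implicit Types (A : set R) (r s : R).

Lemma diam_ge0 A : (0 <= diam A)%E.
Proof. by rewrite /diam le_max lexx. Qed.

Lemma diam_set0 : diam (set0 : set R) = 0%E.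
Proof.
rewrite /diam; suff -> : [set (`|x - y|)%:E | x in (set0 : set R) & y in set0] = set0.
  by rewrite ereal_sup0.
by rewrite -subset0 => y [x []].
Qed.

Lemma diam_le A r : 0 <= r ->
  (forall x y, A x -> A y -> `|x - y| <= r) -> (diam A <= r%:E)%E.
Proof.
move=> r_ge0 Ar; rewrite /diam ge_max lee_fin r_ge0 /=.
by apply: ge_ereal_sup => _ [x Ax [y Ay <-]]; rewrite lee_fin Ar.
Qed.

Lemma le_diam A x y : A x -> A y -> ((`|x - y|)%:E <= diam A)%E.
Proof.
move=> Ax Ay; rewrite /diam le_max; apply/orP; right.
by apply: ereal_sup_ubound; exists x => //; exists y.
Qed.

Lemma diam_pow_set0 s : diam_pow s (set0 : set R) = 0%E.
Proof. by rewrite /diam_pow eqxx. Qed.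

Lemma diam_pow_ge0 s A : (0 <= diam_pow s A)%E.
Proof. by rewrite /diam_pow; case: ifP => // _; exact: poweR_ge0. Qed.

Lemma diam_pow_le s A r : 0 <= r -> 0 <= s ->
  (forall x y, A x -> A y -> `|x - y| <= r) -> (diam_pow s A <= (r `^ s)%:E)%E.
Proof.
move=> r_ge0 s_ge0 Ar; rewrite /diam_pow; case: ifP => _.
  by rewrite lee_fin powR_ge0.
rewrite -poweR_EFin; apply: gt0_ler_poweR => //; last exact: diam_le.
  by rewrite in_itv /= diam_ge0 leey.
by rewrite in_itv /= lee_fin r_ge0 leey.
Qed.

(** Holds because powers with [s > 0] are strictly increasing; an infinite diameter would have
    infinite weight. *)
Lemma diam_pow_le_diam s r A : 0 < s -> 0 <= r ->
  (diam_pow s A <= (r `^ s)%:E)%E -> (diam A <= r%:E)%E.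
Proof.
move=> s_gt0 r_ge0; rewrite /diam_pow; case: ifP => [/eqP -> _|_ Ars].
  by rewrite diam_set0 lee_fin.
rewrite leNgt; apply/negP => rA; move: Ars rA; have := diam_ge0 A.
case: (diam A) => [d| |]//; last by rewrite poweRyr ?gt_eqF.
rewrite poweR_EFin !lee_fin lte_fin => d_ge0 drs rd.
by have := gt0_ltr_powR s_gt0 r_ge0 d_ge0 rd; rewrite ltNge drs.
Qed.

(* On the discrete sigma-algebra every cover is a cover by measurable sets, so
   that the outer measure construction applies to arbitrary covers. *)
Local Notation discreteR := (g_sigma_algebraType [set: set R]).

Definition hcontent s : set discreteR -> \bar R :=
  @mu_ext _ discreteR R (diam_pow s).

HB.instance Definition _ s := isOuterMeasure.Build R discreteR (hcontent s)
  (@mu_ext0 _ discreteR R _ (diam_pow_set0 s) (diam_pow_ge0 s))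
  (@mu_ext_ge0 _ discreteR R _ (diam_pow_ge0 s))
  (@le_mu_ext _ discreteR R (diam_pow s))
  (@mu_ext_sigma_subadditive _ discreteR R _ (diam_pow_ge0 s)).

Lemma hcontent_le s A r : 0 <= r -> 0 <= s ->
  (forall x y, A x -> A y -> `|x - y| <= r) -> (hcontent s A <= (r `^ s)%:E)%E.
Proof.
move=> r_ge0 s_ge0 Ar; apply: le_trans (diam_pow_le r_ge0 s_ge0 Ar).
apply: ereal_inf_lbound; exists (fun k => if k is 0%N then A else set0).
  split => [k|x Ax]; last by exists 0%N.
  exact: sub_sigma_algebra.
rewrite nneseries_recl//; last by move=> *; exact: diam_pow_ge0.
rewrite eseries_cond/= eseries0 ?adde0// => -[|]//= k _ _.
by rewrite diam_pow_set0.
Qed.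

Lemma hcontent_cover_lt s A (e : R) : 0 < e -> hcontent s A = 0%E ->
  exists2 U : (set R)^nat, A `<=` \bigcup_k U k &
    (\sum_(0 <= k <oo) diam_pow s (U k) < e%:E)%E.
Proof.
move=> e_gt0 A0; have : (hcontent s A < e%:E)%E by rewrite A0 lte_fin.
by move=> /ereal_inf_lt[_ [U [_ AU] <-] Ue]; exists U.
Qed.

Lemma le_nneseries (f : (\bar R)^nat) k : (forall n, 0 <= f n)%E ->
  (f k <= \sum_(0 <= n <oo) f n)%E.
Proof.
move=> f0; rewrite (@nneseriesD1 _ f k)// leeDl//.
by apply: nneseries_ge0 => *.
Qed.

(** For [s > 0] cheap covers are automatically fine: if the total weight is below the [s]-th power
    of [delta], every set of the cover has diameter at most [delta]. *)
Lemma hausdorff_measure0 s A : 0 < s -> hcontent s A = 0%E ->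
  hausdorff_measure s A = 0%E.
Proof.
move=> s_gt0 A0; have content0 delta : 0 < delta -> hausdorff_content s delta A = 0%E.
  move=> d_gt0; apply/eqP; rewrite eq_le; apply/andP; split; last first.
    by apply: le_ereal_inf_tmp => _ [U _ <-]; apply: nneseries_ge0 => *; exact: diam_pow_ge0.
  apply/lee_addgt0Pr => e e_gt0; rewrite add0e.
  have m_gt0 : 0 < Num.min e (delta `^ s) by rewrite lt_min e_gt0 powR_gt0.
  have [U AU Ue] := hcontent_cover_lt m_gt0 A0.
  apply: (@le_trans _ _ (\sum_(0 <= k <oo) diam_pow s (U k))%E); last first.
    by rewrite (le_trans (ltW Ue))// lee_fin ge_min lexx.
  apply: ereal_inf_lbound; exists U => //; split=> // k.
  apply: (@diam_pow_le_diam s) => //; first exact: ltW.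
  apply: le_trans (@le_nneseries (fun j => diam_pow s (U j)) k _) _ => [n|].
    exact: diam_pow_ge0.
  by rewrite (le_trans (ltW Ue))// lee_fin ge_min lexx orbT.
apply/eqP; rewrite eq_le; apply/andP; split.
  by apply: ge_ereal_sup => _ [d d_gt0 <-]; rewrite content0.
by apply: ereal_sup_ubound; exists 1; [exact: ltr01 | rewrite content0].
Qed.

(** A nonempty set of finite diameter [r] lies in the interval of radius [r] about any of its
    points; the factor 2 is harmless for null sets. *)
Lemma lebesgue_le_diam_pow A : (lebesgue_measure A <= 2%:E * diam_pow 1 A)%E.
Proof.
rewrite /diam_pow; case: ifPn => [/eqP ->|/set0P[x Ax]].
  by rewrite measure0 mule_ge0.
rewrite poweRe1; last exact: diam_ge0.
have [Aoo|] := eqVneq (diam A) +oo%E; first by rewrite Aoo gt0_muley ?leey// lte_fin.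
have := diam_ge0 A; case DA : (diam A) => [r| |]// r_ge0 _.
have AI : A `<=` `[x - r, x + r]%classic.
  move=> y Ay; have := le_diam Ax Ay; rewrite DA lee_fin /= in_itv /= => xyr.
  by rewrite -ler_distlC.
apply: (@le_trans _ _ (lebesgue_measure `[x - r, x + r]%classic)).
  (* [A] may be non-measurable: [lebesgue_measure] is read here as the outer measure built from
     interval lengths. *)
  exact: (le_outer_measure ((wlength idfun)^*)%mu).
rewrite lebesgue_measure_itv /= lte_fin; case: ifP => _.
  by rewrite -EFinB -EFinM lee_fin; lra.
by rewrite mule_ge0.
Qed.

Lemma lebesgue_measure0 A : hcontent 1 A = 0%E -> lebesgue_measure A = 0%E.
Proof.
move=> A0; apply/eqP; rewrite eq_le; apply/andP; split; last first.
  exact: (outer_measure_ge0 ((wlength idfun)^*)%mu).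
apply/lee_addgt0Pr => e e_gt0; rewrite add0e.
have e2_gt0 : 0 < e / 2 by rewrite divr_gt0.
have [U AU /ltW Ue] := hcontent_cover_lt e2_gt0 A0.
apply: le_trans (le_outer_measure ((wlength idfun)^*)%mu _ _ AU) _.
apply: le_trans (outer_measure_sigma_subadditive ((wlength idfun)^*)%mu U) _.
apply: (@le_trans _ _ (\sum_(0 <= k <oo) (2%:E * diam_pow 1 (U k)))%E).
  apply: lee_nneseries => [k _ _|k _]; last exact: lebesgue_le_diam_pow.
  exact: (outer_measure_ge0 ((wlength idfun)^*)%mu).
rewrite nneseriesZl; last by move=> *; exact: diam_pow_ge0.
rewrite (_ : e = 2 * (e / 2)) ?EFinM ?lee_pmul2l//; last by field.
Qed.

(** Borel-Cantelli: for each [N], [A] lies in the union of the [F n] with [n >= N], so its content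
    is at most a tail of a convergent series. *)
Lemma hcontent_limsup0 s (F : (set R)^nat) A :
  (\sum_(1 <= n <oo) hcontent s (F n) < +oo)%E ->
  (forall x, A x -> infinite_set [set n | (0 < n)%N /\ F n x]) ->
  hcontent s A = 0%E.
Proof.
move=> Foo AF; apply/eqP; rewrite eq_le; apply/andP; split; last first.
  exact: outer_measure_ge0.
(* The series starts at 1 and nothing is known of [F 0], so the empty set replaces it. *)
pose G n := if n is 0%N then set0 else F n.
have G0 n : (0 <= hcontent s (G n))%E by exact: outer_measure_ge0.
have GE N : (0 < N)%N -> (\sum_(N <= n <oo) hcontent s (G n) =
    \sum_(N <= n <oo) hcontent s (F n))%E.
  move=> N0; rewrite eseries_cond [RHS]eseries_cond.
  by apply: eq_eseriesr => -[|n]; rewrite //= leqn0 (gtn_eqF N0).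
have Goo : (\sum_(0 <= n <oo) hcontent s (G n) < +oo)%E.
  by rewrite nneseries_recl// [hcontent s (G 0%N)]outer_measure0 add0e GE.
have tail := nneseries_tail_cvg Goo (fun k _ => G0 k).
rewrite -(cvg_lim _ tail)//; apply: lime_ge; first by apply/cvg_ex; exists 0%E.
apply: nearW => N.
apply: le_trans (outer_measure_sigma_subadditive_tail (hcontent s) N G).
apply: le_outer_measure => x /AF xF.
have [n] : exists n, [set n | (0 < n)%N /\ F n x] n /\ (N <= n)%N.
  apply: contrapT => noN; apply: xF; apply: (sub_finite_set _ (finite_II N)).
  move=> n /= xn; rewrite ltnNge; apply/negP => Nn; apply: noN.
  by exists n.
move=> [[n0 Fx] Nn]; exists n; first by apply/negP; rewrite -leqNgt.
by case: n n0 Fx {Nn}.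
Qed.

Lemma hcontent_finite_cover s N A (F : (set R)^nat) (w : nat -> R) :
  A `<=` \bigcup_(i in `I_N) F i ->
  (forall i, (i < N)%N -> (hcontent s (F i) <= (w i)%:E)%E) ->
  (hcontent s A <= (\sum_(i < N) w i)%:E)%E.
Proof.
move=> AF Fw; apply: (@le_trans _ _ (hcontent s (\big[setU/set0]_(i < N) F i))).
  by apply: le_outer_measure; rewrite -bigcup_mkord.
apply: le_trans (outer_measure_subadditive (hcontent s) F N) _.
by rewrite -sumEFin; apply: lee_sum => i _; apply: Fw.
Qed.

End HausdorffContent.

(** * Points close to shifted fractions with denominators [a] and [b] *)

(** Coprimality makes [m1] and [m2] congruent modulo [a]; equal quotients then make them equal. *)
Lemma coprime_lattice_inj (a b m1 m2 : nat) (q1 q2 : int) :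
  (0 < a)%N -> coprime a b ->
  b%:Z * m1%:Z - a%:Z * q1 = b%:Z * m2%:Z - a%:Z * q2 ->
  (m1 %/ a = m2 %/ a)%N -> m1 = m2 /\ q1 = q2.
Proof.
move=> a_gt0 ab mq divm.
have bm : b%:Z * (m1%:Z - m2%:Z) = a%:Z * (q1 - q2) by lia.
have : (a %| b%:Z * (m1%:Z - m2%:Z))%Z by rewrite bm dvdz_mulr.
rewrite Gauss_dvdzr// -eqz_mod_dvd !modz_nat eqz_nat => /eqP modm.
have m12 : m1 = m2 by rewrite (divn_eq m1 a) (divn_eq m2 a) divm modm.
split=> //; move: bm; rewrite m12 subrr mulr0 => /esym/eqP.
by rewrite mulf_eq0 eqz_nat (gtn_eqF a_gt0) subr_eq0 => /eqP.
Qed.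

Section NearPoints.
Context {R : realType}.
Implicit Types (a b : nat) (c d u v s x : R).

(** The floor of [x] or the next integer is a nearest one. The bound 1 is what the dyadic
    decomposition starts from. *)
Lemma dist_int_attained x :
  exists z : int, `|x - z%:~R| = dist_int x /\ `|x - z%:~R| <= 1.
Proof.
pose f := Num.floor x.
have /andP[fx] := floor_itv x; rewrite -/f intrD => xf.
have [z z1 zmin] : exists2 z : int, `|x - z%:~R| <= 1 &
    forall y : int, `|x - z%:~R| <= `|x - y%:~R|.
  have far (y : int) : Num.min (x - f%:~R) (f%:~R + 1 - x) <= `|x - y%:~R|.
    have [yf|] := leP y f.
      have : y%:~R <= f%:~R :> R by rewrite ler_int.
      by rewrite ge_min ler_normr => ?; apply/orP; left; apply/orP; left; lra.
    rewrite -lezD1 -(ler_int R) intrD => ?.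
    by rewrite ge_min; apply/orP; right; rewrite ler_normr; apply/orP; right; lra.
  have [le_half|gt_half] := leP (x - f%:~R) (f%:~R + 1 - x).
    have fE : `|x - f%:~R| = x - f%:~R by rewrite ger0_norm ?subr_ge0.
    exists f => [|y]; rewrite fE; first lra.
    by have := far y; rewrite min_l.
  have fE : `|x - (f + 1)%:~R| = f%:~R + 1 - x.
    by rewrite intrD distrC gtr0_norm ?subr_gt0.
  exists (f + 1) => [|y]; rewrite fE; first lra.
  by have := far y; rewrite min_r// ltW.
exists z; split=> //; apply/eqP; rewrite eq_le; apply/andP; split.
  apply: lb_le_inf; first by exists `|x - z%:~R|; exists z.
  by move=> _ [y _ <-].
apply: ge_inf; last by exists z.
by exists 0 => _ [y _ <-].
Qed.

Definition near_points a b c d u v : set R :=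
  [set x | 0 <= x <= 1 /\ exists p q : int,
    `|a%:R * x + c - p%:~R| <= u /\ `|b%:R * x + d - q%:~R| <= v].

(** Two points with the same [p] and [q] differ by at most [2u/a] and [2v/b], so it remains to count
    the pairs: at most [2W/g + 2] values of [b'p - a'q], each taken by at most [g + 3] pairs. *)
Lemma hcontent_near_points a b c d u v s : (0 < a)%N -> (0 < b)%N ->
  0 < u <= 1 -> 0 < v -> 0 <= s ->
  (hcontent s (near_points a b c d u v) <=
   ((8 * (u * b%:R + v * a%:R) + 8 * (gcdn a b)%:R) *
    (2 * Num.min (u / a%:R) (v / b%:R)) `^ s)%:E)%E.
Proof.
move=> a_gt0 b_gt0 /andP[u_gt0 u_le1] v_gt0 s_ge0.
set g := gcdn a b; set a' := (a %/ g)%N; set b' := (b %/ g)%N.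
have g_gt0 : (0 < g)%N by rewrite gcdn_gt0 a_gt0.
have aE : a = (a' * g)%N by rewrite divnK// dvdn_gcdl.
have bE : b = (b' * g)%N by rewrite divnK// dvdn_gcdr.
have a'_gt0 : (0 < a')%N by move: a_gt0; rewrite aE muln_gt0 => /andP[].
have cop : coprime a' b' by rewrite /coprime -(eqn_pmul2r g_gt0) muln_gcdl -aE -bE mul1n.
have aR : 0 < a%:R :> R by rewrite ltr0n.
have bR : 0 < b%:R :> R by rewrite ltr0n.
have gR : 1 <= g%:R :> R by rewrite ler1n.
have gR0 : 0 < g%:R :> R by rewrite ltr0n.
set W := u * b%:R + v * a%:R.
have W_gt0 : 0 < W by rewrite addr_gt0 ?mulr_gt0.
set w := _ `^ s.
(* As [u <= 1] and [0 <= ax <= a], every relevant [p] satisfies [P <= p < P + a + 3]. *)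
have [P Pc cP] : exists2 P : int, P%:~R + 1 <= c & c < P%:~R + 2.
  exists (Num.floor c - 1); have /andP[] := floor_itv c; rewrite intrD intrB; lra.
(* [th] is the left end of the window of length [2W/g] that contains [b'p - a'q]; [L] and [K]
   enclose its integers. *)
pose th := (b%:R * c - a%:R * d - W) / g%:R.
have [L Lth thL] : exists2 L : int, L%:~R <= th & th < L%:~R + 1.
  by exists (Num.floor th); have /andP[] := floor_itv th; rewrite intrD.
have [K leK Kle] : exists2 K : nat, 2 * W / g%:R + 1 < K%:R & K%:R <= 2 * W / g%:R + 2.
  have : 0 <= 2 * W / g%:R by rewrite divr_ge0 ?mulr_ge0 ?ltW.
  move=> /truncn_itv/andP[le_t t_lt].
  by exists (Num.truncn (2 * W / g%:R)).+2; rewrite -natr1; lra.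
(* The pair (k, j) determines p = P + m and q: the value of b'p - a'q fixes p
   modulo a', and the quotient j then fixes m. *)
pose F k j := [set x | exists (m : nat) (q : int),
  [/\ `|a%:R * x + c - (P + m%:Z)%:~R| <= u, `|b%:R * x + d - q%:~R| <= v,
      b'%:Z * (P + m%:Z) - a'%:Z * q = L + k%:Z & (m %/ a')%N = j]].
have Fw k j : (hcontent s (F k j) <= w%:E)%E.
  apply: hcontent_le => // [|x y [m1 [q1 [x1 x2 k1 j1]]] [m2 [q2 [y1 y2 k2 j2]]]].
    by rewrite mulr_ge0// le_min !divr_ge0 ?ltW.
  have [||mE qE] := @coprime_lattice_inj a' b' m1 m2 q1 q2 a'_gt0 cop.
  - by move: (etrans k1 (esym k2)); rewrite !mulrDr -!addrA => /addrI.
  - by rewrite j1 j2.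
  subst m2 q2; rewrite minr_pMr// le_min; apply/andP; split.
    rewrite mulrA ler_pdivlMr// -[X in _ * X]gtr0_norm// -normrM.
    by move: x1 y1; rewrite !ler_norml => /andP[? ?] /andP[? ?]; apply/andP; split; lra.
  rewrite mulrA ler_pdivlMr// -[X in _ * X]gtr0_norm// -normrM.
  by move: x2 y2; rewrite !ler_norml => /andP[? ?] /andP[? ?]; apply/andP; split; lra.
have cover : near_points a b c d u v `<=`
    \bigcup_(k in `I_K) \bigcup_(j in `I_(g + 3)) F k j.
  move=> x [/andP[x0 x1] [p [q [xp xq]]]].
  have ax_le : a%:R * x <= a%:R by rewrite ler_piMr.
  have ax_ge0 : 0 <= a%:R * x by rewrite mulr_ge0.
  move: (xp) (xq); rewrite !ler_norml => /andP[p1 p2] /andP[q1 q2].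
  have Pp : P <= p.
    by rewrite -(ler_int R); lra.
  have pP : p < P + (a + 3)%:Z.
    by rewrite -(ltr_int R) intrD -pmulrn natrD; lra.
  have [m pE] : exists m : nat, p = P + m%:Z.
    by exists `|p - P|%N; rewrite gez0_abs ?subr_ge0// subrKC.
  have k0 : g%:R * (b'%:Z * p - a'%:Z * q)%:~R = b%:R * p%:~R - a%:R * q%:~R :> R.
    by rewrite intrB !intrM aE bE !natrM; ring.
  (* Eliminating [x] from the two approximations confines [bp - aq] to a window of radius [W]. *)
  have bp : `|b%:R * p%:~R - a%:R * q%:~R - (b%:R * c - a%:R * d)| <= W.
    have -> : b%:R * p%:~R - a%:R * q%:~R - (b%:R * c - a%:R * d) =
        a%:R * (b%:R * x + d - q%:~R) - b%:R * (a%:R * x + c - p%:~R) by ring.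
    apply: le_trans (ler_normB _ _) _; rewrite !normrM !normr_nat /W addrC.
    by rewrite lerD// mulrC ler_wpM2r.
  move: bp; rewrite -k0 ler_norml => /andP[W_le le_W].
  have thE : g%:R * th = b%:R * c - a%:R * d - W by rewrite /th mulrC divfK ?gt_eqF.
  set k' := b'%:Z * p - a'%:Z * q in k0 W_le le_W *.
  have thk : th <= k'%:~R by rewrite -(ler_pM2l gR0) thE; lra.
  have kth : k'%:~R <= th + 2 * W / g%:R.
    rewrite -(ler_pM2l gR0) mulrDr thE mulrCA divff ?gt_eqF// mulr1; lra.
  have Lk : L <= k' by rewrite -(ler_int R) (le_trans Lth).
  have kK : k' < L + K%:Z by rewrite -(ltr_int R) intrD -pmulrn; lra.
  have [k kE] : exists k : nat, k' = L + k%:Z.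
    by exists `|k' - L|%N; rewrite gez0_abs ?subr_ge0// subrKC.
  exists k; first by move: kK; rewrite kE ltrD2l ltz_nat.
  exists (m %/ a')%N; last by exists m, q; split=> //; rewrite -pE.
  (* Since [a' >= 1], [m < a'g + 3 <= (g + 3)a']. *)
  rewrite /= ltn_divLR//.
  have : (m < a + 3)%N by move: pP; rewrite pE ltrD2l ltz_nat.
  move=> /leq_trans; apply; rewrite {1}aE mulnDl mulnC leq_add2l leq_pmulr//.
have Fkw k : (hcontent s (\bigcup_(j in `I_(g + 3)) F k j) <= ((g + 3)%:R * w)%:E)%E.
  rewrite mulr_natl -[X in _ *+ X]card_ord -sumr_const.
  by apply: (@hcontent_finite_cover _ _ _ _ (F k) (fun=> w)).
apply: le_trans (hcontent_finite_cover cover (fun k _ => Fkw k)) _.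
rewrite sumr_const card_ord -[X in X%:E]mulr_natl.
have w_ge0 : 0 <= w by exact: powR_ge0.
rewrite lee_fin mulrA ler_wpM2r//.
(* The factor [4g] bounds [g + 3], as [g >= 1]. *)
have -> : 8 * W + 8 * g%:R = (2 * W / g%:R + 2) * (4 * g%:R).
  by field; rewrite gt_eqF.
apply: ler_pM => //; first by rewrite natrD; lra.
Qed.

End NearPoints.

(** * Geometric sums and dyadic levels *)

Section DyadicSums.
Context {R : realType}.
Implicit Types (q y s t e psi : R) (a b : nat).

Lemma sum_exprn_le q n : 0 <= q < 1 -> \sum_(i < n) q ^+ i <= (1 - q)^-1.
Proof.
move=> /andP[q_ge0 q_lt1]; rewrite -[leRHS]mul1r ler_pdivlMr ?subr_gt0//.
have -> : (\sum_(i < n) q ^+ i) * (1 - q) = 1 - q ^+ n.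
  by rewrite -[RHS]opprB subrX1; ring.
by rewrite gerBl exprn_ge0.
Qed.

(** The terms decay geometrically on both sides of the place where [y * q ^+ i] crosses 1, and each
    side contributes at most [1/(1 - q)]. *)
Lemma sum_min_inv_le q y n : 0 < q < 1 -> 0 < y ->
  \sum_(i < n) Num.min (y * q ^+ i) (y * q ^+ i)^-1 <= 2 / (1 - q).
Proof.
move=> /andP[q_gt0 q_lt1]; have q1 : 0 < 1 - q by rewrite subr_gt0.
have small m z : 0 < z <= 1 ->
    \sum_(i < m) Num.min (z * q ^+ i) (z * q ^+ i)^-1 <= (1 - q)^-1.
  move=> /andP[z_gt0 z_le1]; apply: le_trans (sum_exprn_le m _); last first.
    by rewrite ltW.
  by apply: ler_sum => i _; rewrite ge_min ler_piMl// exprn_ge0// ltW.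
(* The slack q / ((1 - q) y) is what the terms with y q^i > 1, which increase
   with i, have not used up yet. *)
have big m : forall z, 1 < z ->
    \sum_(i < m) Num.min (z * q ^+ i) (z * q ^+ i)^-1 <= 2 / (1 - q) - q / (1 - q) / z.
  elim: m => [|m IH] z z_gt1.
    rewrite big_ord0 -mulrA -invfM subr_ge0 ler_pdivrMr ?mulr_gt0//; last lra.
    rewrite mulrA divfK ?gt_eqF//; lra.
  have z_gt0 : 0 < z by lra.
  rewrite big_ord_recl expr0 mulr1.
  under eq_bigr => i _ do rewrite lift0 exprS mulrA.
  have minz : Num.min z z^-1 <= z^-1 by rewrite ge_min lexx orbT.
  have [zq_le1|zq_gt1] := leP (z * q) 1.
    have := @small m (z * q); rewrite mulr_gt0//= zq_le1 => /(_ isT) IHm.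
    apply: le_trans (lerD minz IHm) _.
    have zV : z^-1 < 1 by rewrite invf_lt1.
    have -> : 2 / (1 - q) - q / (1 - q) / z = (1 - q)^-1 + z^-1 + (1 - z^-1) / (1 - q).
      by field; rewrite !gt_eqF.
    by rewrite addrC lerDl divr_ge0 ?subr_ge0 ?ltW.
  (* Here [z^-1] plus the bound for [z * q] is exactly the bound for [z]. *)
  apply: le_trans (lerD minz (IH _ zq_gt1)) _.
  rewrite le_eqVlt; apply/orP; left; apply/eqP.
  by field; rewrite !gt_eqF.
move=> y_gt0; have [y_le1|y_gt1] := leP y 1.
  apply: le_trans (small _ _ _) _; first by rewrite y_gt0.
  by rewrite ler_peMl ?invr_ge0 ?ltW//; lra.
apply: le_trans (big n _ y_gt1) _.
by rewrite gerBl !divr_ge0// ltW.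
Qed.

(** If [t] is at most the last scale, [i = n] works because [2 * psi * 2 ^+ n >= 2]. Otherwise the
    least [i] with [2^-1 ^+ i.+1 < t] works, as then [r] is at most [psi] times [2 ^+ i.+1]. *)
Lemma dyadic_level psi t r n : 0 <= r <= 1 -> t <= 1 -> t * r < psi ->
  2^-1 ^+ n <= psi ->
  exists2 i, (i < n.+1)%N & t <= 2^-1 ^+ i /\ r <= 2 * psi * 2 ^+ i.
Proof.
move=> /andP[r_ge0 r_le1] t_le1 trpsi n_psi.
have [tn|nt] := leP t (2^-1 ^+ n).
  exists n => //; split=> //; apply: le_trans r_le1 _.
  have := ler_wpM2r (exprn_ge0 n (ler0n R 2)) n_psi.
  by rewrite -exprMn mulVf ?pnatr_eq0// expr1n; lra.
have : exists i, 2^-1 ^+ i.+1 < t.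
  by case: n {n_psi} nt => [|n nt]; [rewrite expr0; lra | exists n].
move=> /ex_minnP[i it imin].
have ni : (i < n)%N.
  case: n nt {n_psi} imin => [|n nt]; first by rewrite expr0; lra.
  by move=> /(_ _ nt).
exists i; first exact: ltnW.
split.
  case: i it imin {ni} => [|i it imin]; first by rewrite expr0.
  by rewrite leNgt; apply/negP => /imin; rewrite ltnn.
have i2 : 2^-1 ^+ i.+1 * 2 ^+ i.+1 = 1 :> R.
  by rewrite -exprMn mulVf ?pnatr_eq0// expr1n.
have : 2^-1 ^+ i.+1 * r <= psi.
  by apply: le_trans (ltW trpsi); rewrite ler_wpM2r// ltW.
move=> /(ler_wpM2r (exprn_ge0 i.+1 (ler0n R 2))).
by rewrite mulrAC i2 mul1r exprS; lra.
Qed.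

End DyadicSums.

(** * Summation of the covering bounds over the levels *)

Section LevelBounds.
Context {R : realType}.
Implicit Types (s psi : R) (a b : nat).

Lemma ler_powR_base s (x y : R) : 0 <= s -> 0 <= x -> x <= y -> x `^ s <= y `^ s.
Proof.
by move=> s_ge0 x_ge0 xy; rewrite ge0_ler_powR// nnegrE (le_trans x_ge0).
Qed.

Lemma half_powR_itv s : 0 < s -> 0 < (2^-1 : R) `^ s < 1.
Proof.
move=> s_gt0; rewrite powR_gt0//=.
have := @gt0_ltr_powR R s s_gt0 2^-1 1; rewrite powR1; apply.
- by rewrite nnegrE.
- by rewrite nnegrE.
- by rewrite invf_lt1// ltr1n.
Qed.

Lemma exprn_powR (k s : R) n : 0 <= k -> (k ^+ n) `^ s = (k `^ s) ^+ n.
Proof. by move=> k_ge0; rewrite -!powR_mulrn ?powR_ge0// powRAC. Qed.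

(** Collecting the powers of [e] shows the dependence on [e]: nondecreasing for [s <= 1], decay for
    [s > 1] and [psi > 0]. *)
Lemma mulr_divr_powR s psi (e : R) : 0 < e -> 0 <= psi ->
  e * (psi / e) `^ s = e `^ (1 - s) * psi `^ s.
Proof.
move=> e_gt0 psi_ge0; have e_ge0 := ltW e_gt0.
rewrite powRM ?invr_ge0// -powR_inv1// -powRrM mulN1r.
rewrite powRD ?(gt_eqF e_gt0) ?implybT//. rewrite powRr1//; ring.
Qed.

Lemma scaled_powR_le s psi (e t : R) : 0 < s <= 1 -> 0 <= psi -> 0 < e -> 0 < t ->
  t * e * (4 * psi / (t * e)) `^ s <= 4 * t `^ (1 - s) * (e * (psi / e) `^ s).
Proof.
move=> s01 psi_ge0 e_gt0 t_gt0; have [e_ge0 t_ge0] := (ltW e_gt0, ltW t_gt0).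
rewrite !mulr_divr_powR ?mulr_gt0//; last by rewrite mulr_ge0.
rewrite !powRM//.
have -> : 4 * t `^ (1 - s) * (e `^ (1 - s) * psi `^ s) =
  4 * (t `^ (1 - s) * e `^ (1 - s) * psi `^ s) by ring.
rewrite mulrCA ler_wpM2r ?mulr_ge0 ?powR_ge0//.
by apply: ler1_powR; [rewrite ler1n | case/andP: s01].
Qed.

Lemma mulr_divr_powR_le s psi (e f : R) : s <= 1 -> 0 <= psi -> 0 < e <= f ->
  e * (psi / e) `^ s <= f * (psi / f) `^ s.
Proof.
move=> s1 psi_ge0 /andP[e_gt0 ef]; have f_gt0 := lt_le_trans e_gt0 ef.
rewrite !mulr_divr_powR// ler_wpM2r ?powR_ge0//.
by rewrite ler_powR_base ?subr_ge0// ltW.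
Qed.

Section Levels.
Variables (a b : nat) (psi s : R) (I : nat).
Hypotheses (a_gt0 : (0 < a)%N) (le_ab : (a <= b)%N) (psi_gt0 : 0 < psi).
Hypotheses (s01 : 0 < s <= 1) (psiI : psi * 2 ^+ I <= 2).

(** The tolerances of a level have constant product [2 * psi]; [w i] is the weight of one covering
    set. The ratio [q] is below 1 for [s < 1] and equals 1 for [s = 1]. *)
Let u i : R := 2^-1 ^+ i.
Let v i : R := 2 * psi * 2 ^+ i.
Let w i : R := (2 * Num.min (u i / a%:R) (v i / b%:R)) `^ s.
Let q : R := 2^-1 `^ (1 - s).
Let X : R := b%:R * (psi / b%:R) `^ s.

Let aR : 0 < a%:R :> R. Proof. by rewrite ltr0n. Qed.
Let bR : 0 < b%:R :> R. Proof. by rewrite ltr0n (leq_trans a_gt0). Qed.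
Let s_ge0 : 0 <= s. Proof. by case/andP: s01 => /ltW. Qed.
Let s_le1 : s <= 1. Proof. by case/andP: s01. Qed.
Let u_gt0 i : 0 < u i. Proof. by rewrite exprn_gt0. Qed.
Let v_gt0 i : 0 < v i. Proof. by rewrite !mulr_gt0 ?exprn_gt0. Qed.
Let uv i : v i * u i = 2 * psi.
Proof. by rewrite /u /v -mulrA -exprMn divff ?expr1n ?mulr1. Qed.

Let min_ge0 i : 0 <= 2 * Num.min (u i / a%:R) (v i / b%:R).
Proof. by rewrite mulr_ge0// le_min !divr_ge0// ltW. Qed.

Let w_le_v i : w i <= (2 * v i / b%:R) `^ s.
Proof.
apply: ler_powR_base => //.
by rewrite -mulrA ler_pM2l// ge_min lexx orbT.
Qed.

Let w_le_u i : w i <= (2 * u i / a%:R) `^ s.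
Proof.
apply: ler_powR_base => //.
by rewrite -mulrA ler_pM2l// ge_min lexx.
Qed.

Let u_sum : \sum_(i < I.+1) u i * b%:R * w i <= 4 * X * \sum_(i < I.+1) q ^+ i.
Proof.
rewrite mulr_sumr; apply: ler_sum => i _.
apply: (@le_trans _ _ (4 * u i `^ (1 - s) * X)); last first.
  by rewrite /u exprn_powR// -/q mulrAC.
apply: le_trans _ (scaled_powR_le s01 (ltW psi_gt0) bR (u_gt0 i)).
rewrite ler_wpM2l//; first by rewrite mulr_ge0 ?ltW.
(* The [v] side of the minimum is used, as [2v/b = 4psi/(ub)] matches the factor [ub]. *)
apply: le_trans (w_le_v i) _.
suff -> : 2 * v i / b%:R = 4 * psi / (u i * b%:R) by [].
have -> : 4 * psi = 2 * (v i * u i) by rewrite uv; ring.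
by field; rewrite !gt_eqF.
Qed.

Let v_sum : \sum_(i < I.+1) v i * a%:R * w i <= 16 * X * \sum_(i < I.+1) q ^+ i.
Proof.
(* The levels are reversed since [v] grows with the level; [psiI] bounds the last [v] by 4. *)
rewrite (reindex_inj rev_ord_inj) mulr_sumr; apply: ler_sum => i _ /=.
rewrite subSS; set j := (I - i)%N.
have v4 : v j <= 4 * 2^-1 ^+ i.
  rewrite -ler_pdivrMr ?exprn_gt0// exprVn invrK /v -!mulrA -exprD subnK; last first.
    by rewrite -ltnS.
  by rewrite [leRHS](_ : 4 = 2 * 2) ?ler_pM2l//; ring.
apply: (@le_trans _ _ (4 * v j `^ (1 - s) * X)); last first.
  rewrite [leRHS]mulrAC ler_wpM2r//; first by rewrite mulr_ge0 ?powR_ge0 ?ltW.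
  apply: (@le_trans _ _ (4 * (4 * q ^+ i))); last by rewrite mulrA -natrM.
  rewrite ler_pM2l// -exprn_powR//.
  apply: (@le_trans _ _ ((4 * 2^-1 ^+ i) `^ (1 - s))).
    by apply: ler_powR_base; [by rewrite subr_ge0 | exact: ltW | ].
  rewrite powRM ?exprn_ge0// ler_wpM2r ?powR_ge0//.
  by apply: ler1_powR; rewrite ?ler1n// gerBl.
apply: (@le_trans _ _ (v j * a%:R * (4 * psi / (v j * a%:R)) `^ s)).
  rewrite ler_wpM2l//; first by rewrite mulr_ge0 ?ltW.
  apply: le_trans (w_le_u j) _.
  suff -> : 2 * u j / a%:R = 4 * psi / (v j * a%:R) by [].
  have -> : 4 * psi = 2 * (v j * u j) by rewrite uv; ring.
  by field; rewrite !gt_eqF.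
apply: le_trans (scaled_powR_le s01 (ltW psi_gt0) aR (v_gt0 j)) _.
rewrite ler_wpM2l ?mulr_ge0 ?powR_ge0//.
(* The assumption [a <= b] absorbs the sum with [a] into [X]. *)
apply: mulr_divr_powR_le; [exact: s_le1 | exact: ltW | by rewrite aR ler_nat].
Qed.

Let w_sum : \sum_(i < I.+1) w i <=
  8 / (1 - 2^-1 `^ s) * (psi / (a%:R * b%:R)) `^ (s / 2).
Proof.
have z2_gt0 : 0 < b%:R / (2 * psi * a%:R) by rewrite divr_gt0 ?mulr_gt0.
(* With [rho] the geometric mean of [u i / a] and [v i / b], which does not depend on [i], these are
   [rho * t] and [rho / t] for [t = z * 2^-1 ^+ i]. *)
pose z := Num.sqrt (b%:R / (2 * psi * a%:R)).
have z_gt0 : 0 < z by rewrite sqrtr_gt0.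
have zz : z ^+ 2 = b%:R / (2 * psi * a%:R) by rewrite sqr_sqrtr// ltW.
pose rho := (a%:R * z)^-1.
have rho_gt0 : 0 < rho by rewrite invr_gt0 mulr_gt0.
have rho2 : rho ^+ 2 = 2 * (psi / (a%:R * b%:R)).
  by rewrite /rho exprVn exprMn zz; field; rewrite !gt_eqF.
have s_gt0 : 0 < s by case/andP: s01.
have wE i : w i = 2 `^ s * rho `^ s *
    Num.min (z `^ s * (2^-1 `^ s) ^+ i) (z `^ s * (2^-1 `^ s) ^+ i)^-1.
  pose t := z * 2^-1 ^+ i.
  have t_gt0 : 0 < t by rewrite mulr_gt0 ?exprn_gt0.
  have -> : z `^ s * (2^-1 `^ s) ^+ i = t `^ s.
    by rewrite -exprn_powR// -powRM ?ltW ?exprn_gt0.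
  rewrite -[(t `^ s)^-1]powRN -(mulN1r s) powRrM powR_inv1 ?(ltW t_gt0)//.
  have -> : Num.min (t `^ s) (t^-1 `^ s) = (Num.min t t^-1) `^ s.
    have [tt|tt] := leP t t^-1.
      by rewrite min_l// ler_powR_base// ltW.
    by rewrite min_r// ler_powR_base ?invr_ge0 ?(ltW t_gt0) ?(ltW tt).
  have min_t : 0 <= Num.min t t^-1 by rewrite le_min invr_ge0 (ltW t_gt0).
  have rho_ge0 := ltW rho_gt0.
  rewrite -!powRM ?mulr_ge0// /w -mulrA.
  congr ((2 * _) `^ s); rewrite minr_pMr ?ltW//; congr Num.min.
    by rewrite /t /rho /u; field; rewrite !gt_eqF.
  have -> : v i = 2 * psi / u i by rewrite -(uv i) mulfK// gt_eqF.
  have -> : 2 * psi / u i / b%:R = (2 * psi * a%:R / b%:R) / (a%:R * u i).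
    by field; rewrite !gt_eqF.
  rewrite -[2 * psi * a%:R / b%:R]invf_div -zz /t /rho -/(u i).
  by field; rewrite !gt_eqF.
under eq_bigr => i _ do rewrite wE.
rewrite -mulr_sumr.
have q'01 := half_powR_itv s_gt0.
have q'1 : 0 < 1 - (2^-1 : R) `^ s by rewrite subr_gt0; case/andP: q'01.
apply: (@le_trans _ _ (2 `^ s * rho `^ s * (2 / (1 - 2^-1 `^ s)))).
  rewrite ler_wpM2l ?mulr_ge0 ?powR_ge0//.
  by apply: sum_min_inv_le => //; rewrite powR_gt0.
have rhos : rho `^ s <= 2 * (psi / (a%:R * b%:R)) `^ (s / 2).
  rewrite (_ : rho `^ s = (rho ^+ 2) `^ (s / 2)); last first.
    by rewrite -powR_mulrn ?ltW// -powRrM; congr (_ `^ _); field.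
  have D_ge0 : 0 <= psi / (a%:R * b%:R) by rewrite divr_ge0 ?(ltW psi_gt0).
  rewrite rho2 powRM// ler_wpM2r ?powR_ge0//.
  by apply: ler1_powR; rewrite ?ler1n// ler_pdivrMr// mul1r (le_trans s_le1)// ler1n.
(* One 2 comes from the diameter, one from [rho ^+ 2], one from the two-sided geometric sum. *)
rewrite -[8](_ : 2 * 2 * 2 = 8) -?natrM//.
have s2 : (2 : R) `^ s <= 2 by rewrite ler1_powR ?ler1n.
have : 2 `^ s * rho `^ s <= 2 * (2 * (psi / (a%:R * b%:R)) `^ (s / 2)).
  by rewrite ler_pM ?powR_ge0.
move=> /(ler_wpM2r (_ : 0 <= 2 / (1 - 2^-1 `^ s))) H.
apply: le_trans (H _) _; first by rewrite divr_ge0// ltW.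
by rewrite !natrM le_eqVlt; apply/orP; left; apply/eqP; ring.
Qed.

(** The constants are [160 = 8 * (4 + 16)] and [64 = 8 * 8]. The sum of powers of [q] stays
    unevaluated to serve both [s < 1] and [s = 1]. *)
Lemma level_sum_le :
  \sum_(i < I.+1) (8 * (u i * b%:R + v i * a%:R) + 8 * (gcdn a b)%:R) * w i <=
  160 * X * \sum_(i < I.+1) q ^+ i +
  64 / (1 - 2^-1 `^ s) * ((gcdn a b)%:R * (psi / (a%:R * b%:R)) `^ (s / 2)).
Proof.
rewrite (eq_bigr (fun i : 'I_I.+1 => 8 * (u i * b%:R * w i) +
  8 * (v i * a%:R * w i) + 8 * (gcdn a b)%:R * w i)); last by move=> i _; ring.
rewrite !big_split /= -!mulr_sumr.
have gw : 8 * (gcdn a b)%:R * \sum_(i < I.+1) w i <= 8 * (gcdn a b)%:R *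
    (8 / (1 - 2^-1 `^ s) * (psi / (a%:R * b%:R)) `^ (s / 2)).
  by rewrite ler_wpM2l// mulr_ge0.
apply: le_trans (lerD (lerD (ler_wpM2l _ u_sum) (ler_wpM2l _ v_sum)) gw) _ => //.
by rewrite le_eqVlt; apply/orP; left; apply/eqP; ring.
Qed.

End Levels.
End LevelBounds.

(** * Content of the set attached to a single index *)

Section ProductSets.
Context {R : realType}.
Implicit Types (s psi c d : R) (a b : nat).

(** Pieces of length [1/N] have total weight at most [2 N^(1-s)], which tends to 0. This gives the
    dimension bound 1. *)
Lemma hcontent_unit_itv0 s (A : set R) : 1 < s ->
  A `<=` [set x | 0 <= x <= 1] -> hcontent s A = 0%E.
Proof.
move=> s_gt1 A01; apply/eqP; rewrite eq_le outer_measure_ge0 andbT.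
apply/lee_addgt0Pr => e e_gt0; rewrite add0e.
have s1_gt0 : 0 < s - 1 by rewrite subr_gt0.
pose t := (2 / e) `^ (s - 1)^-1.
pose N := (Num.truncn t).+1.
have tN : t < N%:R by exact: truncnS_gt.
have N_gt0 : 0 < N%:R :> R by rewrite ltr0n.
pose F i := [set x : R | i%:R <= N%:R * x < i.+1%:R].
(* The extra piece, of index [N], holds the endpoint [x = 1]. *)
have AF : A `<=` \bigcup_(i in `I_N.+1) F i.
  move=> x /A01/= /andP[x_ge0 x_le1].
  have Nx_ge0 : 0 <= N%:R * x by rewrite mulr_ge0// ltW.
  exists (Num.truncn (N%:R * x)); last exact: truncn_itv.
  by rewrite /= truncn_lt_nat// (@le_lt_trans _ _ N%:R) ?ltr_nat// ler_piMr// ltW.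
have FN i : (hcontent s (F i) <= ((1 / N%:R) `^ s)%:E)%E.
  apply: hcontent_le; [by rewrite divr_ge0 | lra |] => x y.
  move=> /andP[xi]; rewrite -natr1 => xi1 /andP[yi]; rewrite -natr1 => yi1.
  rewrite ler_pdivlMr// -[X in _ * X]gtr0_norm// -normrM ler_norml.
  by apply/andP; split; lra.
apply: le_trans (hcontent_finite_cover AF (fun i _ => FN i)) _.
rewrite lee_fin sumr_const card_ord -[leLHS]mulr_natl.
apply: (@le_trans _ _ (2 * (N%:R * (1 / N%:R) `^ s))).
  rewrite mulrA ler_wpM2r ?powR_ge0// -natrM ler_nat; lia.
rewrite mulr_divr_powR// powR1 mulr1 -opprB powRN ler_pdivrMr ?powR_gt0//.
rewrite mulrC -ler_pdivrMr//.
have -> : 2 / e = t `^ (s - 1).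
  by rewrite /t -powRrM mulVf ?gt_eqF// powRr1// divr_ge0// ltW.
by apply: ler_powR_base; rewrite ?powR_ge0 ?ltW.
Qed.

Definition product_set a b c d psi : set R :=
  [set x | 0 <= x <= 1 /\
    dist_int (a%:R * x + c) * dist_int (b%:R * x + d) < psi].

Lemma product_set_cover a b c d psi n : 2^-1 ^+ n <= psi ->
  product_set a b c d psi `<=`
  \bigcup_(i in `I_n.+1) near_points a b c d (2^-1 ^+ i) (2 * psi * 2 ^+ i).
Proof.
move=> n_psi x [x01].
have [p [<- p1]] := dist_int_attained (a%:R * x + c).
have [q [<- q1]] := dist_int_attained (b%:R * x + d).
move=> pq; have [|i i_n [pi qi]] := dyadic_level _ p1 pq n_psi.
  by rewrite normr_ge0.
by exists i => //; split=> //; exists p, q.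
Qed.

(** The least [n] with the first property has the second. The first lets the levels cover the
    product set, the second limits their number. *)
Lemma dyadic_scale psi : 0 < psi < 1 ->
  exists2 n, 2^-1 ^+ n <= psi & psi * 2 ^+ n <= 2.
Proof.
move=> /andP[psi_gt0 psi_lt1].
have pow2 n : 2^-1 ^+ n * 2 ^+ n = 1 :> R.
  by rewrite -exprMn mulVf ?pnatr_eq0// expr1n.
have pow2_gt0 n : 0 < 2 ^+ n :> R by rewrite exprn_gt0.
have : exists n, 2^-1 ^+ n <= psi.
  exists (Num.truncn psi^-1).+1; rewrite -[leRHS]invrK exprVn.
  rewrite lef_pV2 ?posrE ?invr_gt0//.
  apply: le_trans (ltW (truncnS_gt _)) _.
  by rewrite -natrX ler_nat ltnW// ltn_expl.
move=> /ex_minnP[n n_psi n_min]; exists n => //.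
case: n n_psi n_min => [|n _ n_min]; first by rewrite expr0; lra.
have : psi < 2^-1 ^+ n by rewrite ltNge; apply/negP => /n_min; rewrite ltnn.
move=> /ltW/(ler_wpM2r (ltW (pow2_gt0 n))); rewrite pow2 exprS; lra.
Qed.

Lemma hcontent_product_set_dyadic a b c d psi s : (0 < a <= b)%N -> 0 < psi < 1 ->
  0 < s <= 1 -> exists2 n, psi * 2 ^+ n <= 2 &
  (hcontent s (product_set a b c d psi) <=
   (160 * (b%:R * (psi / b%:R) `^ s) * \sum_(i < n.+1) (2^-1 `^ (1 - s)) ^+ i +
    64 / (1 - 2^-1 `^ s) *
      ((gcdn a b)%:R * (psi / (a%:R * b%:R)) `^ (s / 2)))%:E)%E.
Proof.
move=> /andP[a_gt0 le_ab] psi01 s01; have [n n_psi psi_n] := dyadic_scale psi01.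
exists n => //; have /andP[psi_gt0 _] := psi01; have /andP[s_gt0 _] := s01.
apply: le_trans (hcontent_finite_cover (product_set_cover n_psi) _) _.
  move=> i _; apply: hcontent_near_points => //; last exact: ltW.
  - exact: leq_trans le_ab.
  - by rewrite exprn_gt0//= exprn_ile1// invf_le1// ler1n.
  - by rewrite !mulr_gt0// exprn_gt0.
by rewrite lee_fin; exact: level_sum_le.
Qed.

(** The unit interval serves as a single covering set, and the right side is at least 1. *)
Lemma hcontent_product_set_psi_ge1 a b c d psi s : (0 < b)%N -> 1 <= psi ->
  0 < s <= 1 ->
  (hcontent s (product_set a b c d psi) <= (b%:R * (psi / b%:R) `^ s)%:E)%E.
Proof.
move=> b_gt0 psi_ge1 /andP[s_gt0 s_le1].
apply: (@le_trans _ _ (1 `^ s)%:E).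
  apply: hcontent_le => //; first exact: ltW.
  move=> x y [/andP[x0 x1] _] [/andP[y0 y1] _]; rewrite ler_norml.
  by apply/andP; split; lra.
rewrite powR1 lee_fin mulr_divr_powR ?ltr0n ?(le_trans ler01)//.
rewrite -[leLHS]mulr1 ler_pM//.
  by rewrite -[leLHS](powRr0 b%:R) ler_powR ?subr_ge0 ?ler1n.
by rewrite -[leLHS](powRr0 psi) ler_powR// ltW.
Qed.

Lemma product_set_psi0 a b c d : product_set a b c d 0 = set0.
Proof.
rewrite -subset0 => x [_]; rewrite ltNge => /negP; apply.
have [p [<- _]] := dist_int_attained (a%:R * x + c).
have [q [<- _]] := dist_int_attained (b%:R * x + d).
exact: mulr_ge0.
Qed.

Lemma tlog_ge1 (x : R) : 1 <= tlog x.
Proof.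
rewrite /tlog; case: ifP => // /negbT; rewrite -ltNge => ex.
rewrite -[leLHS]expRK ler_ln ?posrE ?expR_gt0//; first exact: ltW.
exact: lt_trans (expR_gt0 1) ex.
Qed.

Lemma ln_le_tlog (x : R) : 0 < x -> ln x <= tlog x.
Proof.
move=> x_gt0; rewrite /tlog; case: ifP => // xe.
by rewrite -[leRHS]expRK ler_ln ?posrE ?expR_gt0.
Qed.

(** [C] depends on [s] alone, so the bound can be summed over all indices. Its summands 1, [A] and
    [B] cover [psi >= 1], the geometric series of ratio below 1, and the gcd term. *)
Lemma hcontent_product_set_le s : 0 < s < 1 ->
  exists2 C : R, 0 <= C & forall a b c d psi, (0 < a <= b)%N -> 0 <= psi ->
  (hcontent s (product_set a b c d psi) <=
   (C * (b%:R * (psi / b%:R) `^ s +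
         (gcdn a b)%:R * (psi / (a%:R * b%:R)) `^ (s / 2)))%:E)%E.
Proof.
move=> /andP[s_gt0 s_lt1]; have s01 : 0 < s <= 1 by rewrite s_gt0 ltW.
have /andP[q_gt0 q_lt1] : 0 < (2^-1 : R) `^ (1 - s) < 1.
  by rewrite half_powR_itv// subr_gt0.
have /andP[q'_gt0 q'_lt1] := half_powR_itv s_gt0.
pose A := 160 / (1 - 2^-1 `^ (1 - s)) : R; pose B := 64 / (1 - 2^-1 `^ s) : R.
have A_ge0 : 0 <= A by rewrite divr_ge0// subr_ge0 ltW.
have B_ge0 : 0 <= B by rewrite divr_ge0// subr_ge0 ltW.
exists (1 + A + B) => [|a b c d psi ab psi_ge0]; first by rewrite !addr_ge0.
have /andP[a_gt0 le_ab] := ab; have b_gt0 := leq_trans a_gt0 le_ab.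
set X := b%:R * _; set G := (gcdn a b)%:R * _.
have X_ge0 : 0 <= X by rewrite mulr_ge0 ?powR_ge0.
have G_ge0 : 0 <= G by rewrite mulr_ge0 ?powR_ge0.
have [psi_ge1|psi_lt1] := leP 1 psi.
  apply: le_trans (hcontent_product_set_psi_ge1 _ _ _ b_gt0 psi_ge1 s01) _.
  by rewrite lee_fin -/X; nra.
have [psi_gt0|] := ltP 0 psi; last first.
  move=> psi_le0; rewrite (_ : psi = 0); last by apply/eqP; rewrite eq_le psi_le0.
  by rewrite product_set_psi0 outer_measure0 lee_fin mulr_ge0 ?addr_ge0.
have psi01 : 0 < psi < 1 by rewrite psi_gt0.
have [n _ le_n] := hcontent_product_set_dyadic c d ab psi01 s01.
apply: le_trans le_n _; rewrite lee_fin -/X -/G -/B.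
have : 160 * X * (\sum_(i < n.+1) (2^-1 `^ (1 - s)) ^+ i) <= 160 * X * (1 - 2^-1 `^ (1 - s))^-1.
  apply: ler_wpM2l; first by rewrite mulr_ge0.
  by apply: sum_exprn_le; rewrite powR_ge0.
rewrite [X in _ <= X -> _](_ : _ = A * X); last by rewrite /A; ring.
nra.
Qed.

Lemma hcontent1_product_set_le :
  exists2 C : R, 0 <= C & forall a b c d psi, (0 < a <= b)%N -> 0 <= psi ->
  (hcontent 1 (product_set a b c d psi) <=
   (C * (psi * tlog (1 / psi) +
         (gcdn a b)%:R * (psi / (a%:R * b%:R)) `^ (1 / 2)))%:E)%E.
Proof.
have ln2_gt0 : 0 < ln 2 :> R by rewrite ln_gt0// ltr1n.
have s01 : 0 < (1 : R) <= 1 by rewrite ltr01 lexx.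
pose A : R := 160 * (2 + (ln 2)^-1).
pose B : R := 64 / (1 - 2^-1 `^ 1).
have A_ge0 : 0 <= A by rewrite mulr_ge0// addr_ge0// invr_ge0 ltW.
have B_ge0 : 0 <= B by rewrite /B powRr1// divr_ge0//; lra.
exists (1 + A + B) => [|a b c d psi ab psi_ge0]; first by rewrite !addr_ge0.
have /andP[a_gt0 le_ab] := ab; have b_gt0 := leq_trans a_gt0 le_ab.
set T := tlog _; set G := (gcdn a b)%:R * _.
have T_ge1 : 1 <= T by exact: tlog_ge1.
have G_ge0 : 0 <= G by rewrite mulr_ge0 ?powR_ge0.
have psiT : psi <= psi * T by rewrite ler_peMr.
have XE : b%:R * (psi / b%:R) `^ 1 = psi.
  by rewrite powRr1 ?divr_ge0// mulrC divfK// pnatr_eq0 gtn_eqF.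
have [psi_ge1|psi_lt1] := leP 1 psi.
  apply: le_trans (hcontent_product_set_psi_ge1 _ _ _ b_gt0 psi_ge1 s01) _.
  rewrite lee_fin XE; nra.
have [psi_gt0|] := ltP 0 psi; last first.
  move=> psi_le0; rewrite (_ : psi = 0); last by apply/eqP; rewrite eq_le psi_le0.
  rewrite product_set_psi0 outer_measure0 lee_fin mulr_ge0 ?addr_ge0//.
  by rewrite mulr_ge0// (le_trans ler01).
have psi01 : 0 < psi < 1 by rewrite psi_gt0.
have [n psi_n le_n] := hcontent_product_set_dyadic c d ab psi01 s01.
apply: le_trans le_n _; rewrite lee_fin XE -/G -/B.
(* At [s = 1] the ratio is 1, and the sum just counts the [n + 1] levels. *)
rewrite subrr powRr0 (eq_bigr (fun=> 1)); last by move=> i _; rewrite expr1n.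
rewrite sumr_const card_ord.
(* The logarithm of [2 ^+ n <= 2 / psi]. *)
have n_le : n%:R * ln 2 <= ln 2 + T.
  apply: (@le_trans _ _ (ln 2 + ln (1 / psi))); last first.
    by rewrite lerD2l ln_le_tlog// divr_gt0.
  rewrite mulr_natl -lnXn// -lnM ?posrE ?divr_gt0// ler_ln ?posrE ?mulr_gt0 ?invr_gt0 ?exprn_gt0//.
  by rewrite mulrA mulr1 ler_pdivlMr// mulrC.
have : n.+1%:R <= (2 + (ln 2)^-1) * T.
  rewrite -natr1 -(ler_pM2r ln2_gt0).
  have -> : (2 + (ln 2)^-1) * T * ln 2 = 2 * (T * ln 2) + T by field; rewrite gt_eqF.
  have : ln 2 <= T * ln 2 by rewrite ler_peMl// ltW.
  lra.
move=> /(ler_wpM2l (_ : 0 <= 160 * psi)) H.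
apply: le_trans (lerD (H _) (lexx _)) _; first by rewrite mulr_ge0.
rewrite [X in X + _](_ : _ = A * (psi * T)); last by rewrite /A; ring.
nra.
Qed.

Lemma hcontent_series_lty s (F : (set R)^nat) (X G : nat -> R) (C : R) :
  0 <= C -> (forall n, (0 < n)%N -> 0 <= X n) -> (forall n, (0 < n)%N -> 0 <= G n) ->
  (forall n, (0 < n)%N -> (hcontent s (F n) <= (C * (X n + G n))%:E)%E) ->
  (\sum_(1 <= n <oo) (X n)%:E + \sum_(1 <= n <oo) (G n)%:E < +oo)%E ->
  (\sum_(1 <= n <oo) hcontent s (F n) < +oo)%E.
Proof.
move=> C_ge0 X_ge0 G_ge0 FC; rewrite !(eseries_cond _ _ 1)/= => XG.
rewrite -nneseriesD in XG; [|by move=> n _ n0; rewrite lee_fin X_ge0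
                          |by move=> n _ n0; rewrite lee_fin G_ge0].
apply: (@le_lt_trans _ _ (\sum_(0 <= n <oo | (0 < n)%N)
    (C%:E * ((X n)%:E + (G n)%:E)))%E).
  apply: lee_nneseries => [n _ _|n n0]; first exact: outer_measure_ge0.
  by rewrite -EFinD -EFinM FC.
rewrite nneseriesZl; last first.
  by move=> n n0; rewrite adde_ge0// lee_fin ?X_ge0 ?G_ge0.
by rewrite lte_mul_pinfty// lee_fin.
Qed.

End ProductSets.

(** * Null sets and the dimension bound from the single-index estimates *)

Theorem theorem1p1 (R : realType) (a b : nat -> nat) (c d psi : nat -> R)
    (a_gt0 : forall n, (0 < n)%N -> (0 < a n)%N)
    (b_gt0 : forall n, (0 < n)%N -> (0 < b n)%N)
    (le_ab : forall n, (0 < n)%N -> (a n <= b n)%N)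
    (psi_ge0 : forall n, (0 < n)%N -> 0 <= psi n) :
  [/\ forall s : R, 0 < s < 1 -> hausdorff_cond a b psi s ->
        hausdorff_measure s (approx_set a b c d psi) = 0%E,
      lebesgue_cond a b psi ->
        lebesgue_measure (approx_set a b c d psi) = 0%E
    & (hausdorff_dim (approx_set a b c d psi) <= mine 1 (tau a b psi))%E].
Proof.
pose F n := product_set (a n) (b n) (c n) (d n) (psi n).
have limsup x : approx_set a b c d psi x ->
    infinite_set [set n | (0 < n)%N /\ F n x].
  move=> [x01 inf_x] fin_x; apply: inf_x; apply: sub_finite_set fin_x.
  by move=> n [n_gt0 xn]; split=> //; split.
have ab n : (0 < n)%N -> (0 < a n <= b n)%N by move=> n0; rewrite a_gt0 ?le_ab.
have part_a s : 0 < s < 1 -> hausdorff_cond a b psi s ->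
    hausdorff_measure s (approx_set a b c d psi) = 0%E.
  move=> s01 cond; have [C C_ge0 FC] := hcontent_product_set_le s01.
  have /andP[s_gt0 _] := s01; apply: hausdorff_measure0 => //.
  apply: hcontent_limsup0 limsup; apply: (hcontent_series_lty C_ge0) cond.
  - by move=> n _; rewrite mulr_ge0 ?powR_ge0.
  - by move=> n _; rewrite mulr_ge0 ?powR_ge0.
  - by move=> n n0; apply: FC; [exact: ab | exact: psi_ge0].
(* Every exponent above 1 gives measure 0 to subsets of the unit interval. *)
have dim1 : (hausdorff_dim (approx_set a b c d psi) <= 1)%E.
  apply/lee_addgt0Pr => e e_gt0; apply: ereal_inf_lbound.
  exists (1 + e) => //; split; first by rewrite addr_ge0// ltW.
  apply: hausdorff_measure0; first by rewrite addr_gt0.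
  by apply: hcontent_unit_itv0 => [|x []]; first by rewrite ltrDl.
split=> //.
- move=> cond; have [C C_ge0 FC] := @hcontent1_product_set_le R.
  apply: lebesgue_measure0.
  apply: hcontent_limsup0 limsup; apply: (hcontent_series_lty C_ge0) cond.
  + move=> n n0; rewrite mulr_ge0 ?psi_ge0// (le_trans ler01)//; exact: tlog_ge1.
  + by move=> n _; rewrite mulr_ge0 ?powR_ge0.
  + by move=> n n0; apply: FC; [exact: ab | exact: psi_ge0].
- rewrite le_min dim1 /=; apply: le_ereal_inf_tmp => _ [t [t_gt0 cond] <-].
  (* Part (a) handles only exponents below 1; for the others [dim1] suffices. *)
  have [t_lt1|t_ge1] := ltP t 1; last by rewrite (le_trans dim1)// lee_fin.
  apply: ereal_inf_lbound; exists t => //; split; first exact: ltW.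
  by apply: part_a => //; rewrite t_gt0.
Qed.
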